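(* Consider the LTI process $\mathbf{x}_{t+1}=\mathbf{A}\mathbf{x}_t+\mathbf{w}_t$, $\mathbf{y}_t=\mathbf{C}\mathbf{x}_t+\mathbf{v}_t$ with $\rho^2(\mathbf{A})\ge 1$, $(\mathbf{A},\mathbf{C})$ observable and $(\mathbf{A},\sqrt{\mathbf{W}})$ controllable, whose smart sensor runs a steady-state Kalman filter and sends its local estimate at every time slot over an $M$-state Markov fading channel with transition probability matrix $\mathbf{M}$ and packet drop probability matrix $\mathbf{D}=\mathrm{diag}\{d_1,\dots,d_M\}$ to the remote estimator $\hat{\mathbf{x}}_t=\mathbf{A}^{\delta_t+1}\hat{\mathbf{x}}^s_{t-(\delta_t+1)}$ (all objects as defined in the context). Then the remote estimation system is mean-square stable, i.e. $J=\limsup_{T\to\infty}\frac1T\sum_{t=1}^T\mathsf{E}[\mathrm{Tr}(\mathbf{P}_t)]<\infty$, if and only if $$\rho^2(\mathbf{A})\,\rho(\mathbf{D}\mathbf{M})<1 .$$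
   Context: $\rho(\cdot)$ denotes the spectral radius; $\mathbb{N}=\{1,2,\dots\}$, $\mathbb{N}_0=\{0,1,2,\dots\}$. Process and sensor: $\mathbf{x}_t\in\mathbb{R}^n$, $\mathbf{y}_t\in\mathbb{R}^m$, $\mathbf{A}\in\mathbb{R}^{n\times n}$, $\mathbf{C}\in\mathbb{R}^{m\times n}$; $\mathbf{w}_t$ and $\mathbf{v}_t$ are mutually independent i.i.d. zero-mean Gaussian processes with covariance matrices $\mathbf{W}$ and $\mathbf{V}$. Observability of $(\mathbf{A},\mathbf{C})$ and controllability of $(\mathbf{A},\sqrt{\mathbf{W}})$ mean that $[\mathbf{C}^\top,\mathbf{A}^\top\mathbf{C}^\top,\dots,(\mathbf{A}^n)^\top\mathbf{C}^\top]$ and $[\sqrt{\mathbf{W}},\mathbf{A}\sqrt{\mathbf{W}},\dots,\mathbf{A}^n\sqrt{\mathbf{W}}]$ have full rank. The sensor runs the Kalman filter $\mathbf{P}^s_{t|t-1}=\mathbf{A}\mathbf{P}^s_{t-1|t-1}\mathbf{A}^\top+\mathbf{W}$, $\mathbf{K}_t=\mathbf{P}^s_{t|t-1}\mathbf{C}^\top(\mathbf{C}\mathbf{P}^s_{t|t-1}\mathbf{C}^\top+\mathbf{V})^{-1}$, $\mathbf{P}^s_{t|t}=(\mathbf{I}-\mathbf{K}_t\mathbf{C})\mathbf{P}^s_{t|t-1}$ (the inverse is presupposed to exist), with estimate $\hat{\mathbf{x}}^s_t=\mathbf{x}^s_{t|t}=\mathbf{x}^s_{t|t-1}+\mathbf{K}_t(\mathbf{y}_t-\mathbf{C}\mathbf{x}^s_{t|t-1})$,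 $\mathbf{x}^s_{t|t-1}=\mathbf{A}\mathbf{x}^s_{t-1|t-1}$. Since $(\mathbf{A},\mathbf{C})$ is observable and $(\mathbf{A},\sqrt{\mathbf{W}})$ is controllable, $\mathbf{P}^s_{t|t}$ converges to a finite positive semidefinite matrix $\bar{\mathbf{P}}_0$, and the filter is assumed to be in steady state: $\mathbf{P}^s_{t|t}=\bar{\mathbf{P}}_0$ for all $t$. Channel: $h_t\in\{b_1,\dots,b_M\}$ is a time-homogeneous Markov chain with $p_{i,j}=\mathrm{Prob}[h_{t+1}=b_j\mid h_t=b_i]$, assumed ergodic (irreducible, aperiodic, positive recurrent), and $\mathbf{M}$ is its $M\times M$ transition matrix, $[\mathbf{M}]_{i,j}=p_{i,j}$. $\gamma_t\in\{0,1\}$ indicates failure ($0$) or success ($1$) of the transmission in slot $t$, with $\mathrm{Prob}[\gamma_t=0\mid h_t=b_i]=d_i\in[0,1]$; given the channel states, the $\gamma_t$ are independent, each depending only on $h_t$, and the channel and dropouts are independent of the process and measurement noises. Estimator: $\delta_t\in\mathbb{N}_0$ is the number of consecutive packet dropouts immediately before slot $t$: $\delta_{t+1}=0$ if $\gamma_t=1$ and $\delta_{t+1}=\delta_t+1$ if $\gamma_t=0$ (with some finite deterministic initial value). The remote estimate is $\hat{\mathbf{x}}_t=\mathbf{A}\hat{\mathbf{x}}_{t-1}$ if $\gamma_{t-1}=0$ and $\hat{\mathbf{x}}_t=\mathbf{A}\hat{\mathbf{x}}^s_{t-1}$ if $\gamma_{t-1}=1$, i.e. $\hat{\mathbf{x}}_t=\mathbf{A}^{\delta_t+1}\hat{\mathbf{x}}^s_{t-(\delta_t+1)}$.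 The estimation error covariance in slot $t$ is $\mathbf{P}_t=v^{\delta_t+1}(\bar{\mathbf{P}}_0)$, a random matrix through $\delta_t$, where $v(\mathbf{X})=\mathbf{A}\mathbf{X}\mathbf{A}^\top+\mathbf{W}$, $v^1=v$, $v^{m+1}=v\circ v^m$. The system is called mean-square stable if and only if $J$ is finite. *)

(* Defs.v *)
(* MathComp / MathComp-Analysis development over an arbitrary R : realType. *)
From HB Require Import structures.
From mathcomp Require Import all_boot all_order all_algebra.
From mathcomp Require Import complex.
From mathcomp Require Import all_classical all_reals all_analysis.

Set Implicit Arguments.
Unset Strict Implicit.
Unset Printing Implicit Defensive.

Import Order.TTheory GRing.Theory Num.Theory.
Import numFieldNormedType.Exports.

Local Open Scope classical_set_scope.
Local Open Scope ring_scope.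

Section LinearAlgebra.
Variable R : realType.

(* Largest modulus of a complex eigenvalue; 0 for the empty matrix, since
   sup set0 = 0. *)
Definition spectral_radius (n : nat) (X : 'M[R]_n) : R :=
  sup [set r : R | exists z : R[i],
    eigenvalue (map_mx (real_complex R) X) z /\ real_complex R r = `|z|].

Definition psdmx (n : nat) (X : 'M[R]_n) : Prop :=
  X^T = X /\ forall u : 'cV[R]_n, 0 <= (u^T *m X *m u) 0 0.

Definition is_sqrtmx (n : nat) (S X : 'M[R]_n) : Prop :=
  psdmx S /\ S *m S = X.

Definition observable (n m : nat) (A : 'M[R]_n) (C : 'M[R]_(m, n)) : Prop :=
  \rank (\mxrow_(k < n.+1) ((A ^+ k)^T *m C^T)) = n.

Definition controllable (n p : nat) (A : 'M[R]_n) (B : 'M[R]_(n, p)) : Prop :=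
  \rank (\mxrow_(k < n.+1) (A ^+ k *m B)) = n.

(* The map v; it is also the time update of the Kalman filter. *)
Definition predict_cov (n : nat) (A W X : 'M[R]_n) : 'M[R]_n :=
  A *m X *m A^T + W.

Definition kalman_gain (n m : nat) (C : 'M[R]_(m, n)) (V : 'M[R]_m)
    (X : 'M[R]_n) : 'M[R]_(n, m) :=
  X *m C^T *m invmx (C *m X *m C^T + V).

End LinearAlgebra.

Section ErgodicChains.
Variables (R : realType) (M : nat).
Implicit Types Pi : 'M[R]_M.

Definition stochastic Pi : Prop :=
  (forall i j, 0 <= Pi i j) /\ (forall i, \sum_j Pi i j = 1).

Definition irreducible_chain Pi : Prop :=
  forall i j, exists2 k : nat, (0 < k)%N & 0 < (Pi ^+ k) i j.

Definition aperiodic_chain Pi : Prop :=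
  forall i (p : nat),
    (forall k : nat, (0 < k)%N -> 0 < (Pi ^+ k) i i -> (p %| k)%N) -> p = 1%N.

(* Probability that the chain started in i visits j at time k.+1, for the first
   time after time 0. *)
Fixpoint first_passage Pi (j : 'I_M) (k : nat) (i : 'I_M) : R :=
  match k with
  | 0 => Pi i j
  | k'.+1 => \sum_(l < M | l != j) Pi i l * first_passage Pi j k' l
  end.

Definition positive_recurrent_chain Pi : Prop :=
  forall i,
    (\sum_(0 <= k <oo) (first_passage Pi i k i)%:E = 1)%E /\
    (\sum_(0 <= k <oo) (k.+1%:R * first_passage Pi i k i)%:E < +oo)%E.

Definition ergodic_chain Pi : Prop :=
  [/\ irreducible_chain Pi, aperiodic_chain Pi & positive_recurrent_chain Pi].

End ErgodicChains.

Section Probability.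
Context (R : realType) (disp : measure_display) (Omega : measurableType disp).
Variable P : probability Omega R.

Definition prob (E : set Omega) : R := fine (P E).

(* Meaningful only when prob F != 0. *)
Definition cprob (E F : set Omega) : R := prob (E `&` F) / prob F.

Definition mutually_independent (I : eqType) (G : I -> set (set Omega)) : Prop :=
  forall (s : seq I) (E : I -> set Omega), uniq s ->
    (forall i, i \in s -> G i (E i)) ->
    prob (\big[setI/setT]_(i <- s) E i) = \prod_(i <- s) prob (E i).

Definition random_vector (k : nat) (X : Omega -> 'cV[R]_k) : Prop :=
  forall i, measurable_fun setT (fun omega => X omega i 0).

Definition sigma_vector (k : nat) (X : Omega -> 'cV[R]_k) : set (set Omega) :=
  <<s [set E | exists i (B : set (measurableTypeR R)),
         measurable B /\ E = [set omega | B (X omega i 0)]] >>.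

(* normal_prob takes the standard deviation, and is not a Dirac mass at standard
   deviation 0, so the degenerate case is separate. *)
Definition centered_normal (var : R) (B : set (measurableTypeR R)) : \bar R :=
  if var == 0 then dirac (0 : measurableTypeR R) B
  else normal_prob 0 (Num.sqrt var) B.

(* Gaussian with mean 0 and covariance matrix S: every linear functional of X
   is univariate normal with mean 0 and variance a^T S a. *)
Definition centered_gaussian (k : nat) (S : 'M[R]_k) (X : Omega -> 'cV[R]_k) :
    Prop :=
  random_vector X /\
  forall (a : 'cV[R]_k) (B : set (measurableTypeR R)), measurable B ->
    P [set omega | B ((a^T *m X omega) 0 0)] =
    centered_normal ((a^T *m S *m a) 0 0) B.

End Probability.

Section RemoteEstimation.
Context (R : realType) (disp : measure_display) (Omega : measurableType disp).
Variable P : probability Omega R.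

Record lti_process (n m : nat) (A : 'M[R]_n) (C : 'M[R]_(m, n))
    (x w : nat -> Omega -> 'cV[R]_n) (y v : nat -> Omega -> 'cV[R]_m) : Prop :=
  { lti_init : random_vector (x 0%N);
    lti_state : forall t omega, x t.+1 omega = A *m x t omega + w t omega;
    lti_output : forall t omega, y t omega = C *m x t omega + v t omega }.

(* Ps t stands for P^s_(t|t) and xs t for x^s_(t|t). *)
Record kalman_filter (n m : nat) (A : 'M[R]_n) (C : 'M[R]_(m, n))
    (W : 'M[R]_n) (V : 'M[R]_m) (y : nat -> Omega -> 'cV[R]_m)
    (Ps : nat -> 'M[R]_n) (xs : nat -> Omega -> 'cV[R]_n) : Prop :=
  { kf_unit : forall t,
      C *m predict_cov A W (Ps t) *m C^T + V \in unitmx;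
    kf_cov : forall t,
      Ps t.+1 = (1%:M - kalman_gain C V (predict_cov A W (Ps t)) *m C)
                  *m predict_cov A W (Ps t);
    kf_init : random_vector (xs 0%N);
    kf_estimate : forall t omega,
      xs t.+1 omega = A *m xs t omega +
        kalman_gain C V (predict_cov A W (Ps t))
          *m (y t.+1 omega - C *m (A *m xs t omega)) }.

Definition steady_state (n : nat) (Ps : nat -> 'M[R]_n) (Pbar0 : 'M[R]_n) :
    Prop :=
  psdmx Pbar0 /\ forall t, Ps t = Pbar0.

(* h t omega = i means that the channel is in state b_i in slot t;
   gamma t omega = true means that the transmission in slot t succeeds.
   Conditional probabilities are constrained only where they are defined. *)
Record markov_fading_channel (M : nat) (Pi : 'M[R]_M) (d : 'rV[R]_M)
    (h : nat -> Omega -> 'I_M) (gamma : nat -> Omega -> bool) : Prop :=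
  { ch_measurable : forall t i, measurable [set omega | h t omega = i];
    ch_gamma_measurable : forall t b, measurable [set omega | gamma t omega = b];
    ch_stochastic : stochastic Pi;
    ch_markov : forall t (s : nat -> 'I_M) j,
      let past := [set omega | forall u, (u <= t)%N -> h u omega = s u] in
      prob P past != 0 ->
      cprob P [set omega | h t.+1 omega = j] past = Pi (s t) j;
    ch_drop_range : forall i, 0 <= d 0 i <= 1;
    ch_drop : forall t i,
      prob P [set omega | h t omega = i] != 0 ->
      cprob P [set omega | gamma t omega = false] [set omega | h t omega = i]
      = d 0 i;
    ch_drop_indep : forall t (s : nat -> 'I_M) (g : nat -> bool),
      let states := [set omega | forall u, (u <= t)%N -> h u omega = s u] in
      prob P states != 0 ->
      cprob P [set omega | forall u, (u <= t)%N -> gamma u omega = g u] states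
      = \prod_(u < t.+1)
          cprob P [set omega | gamma u omega = g u]
                  [set omega | h u omega = s u] }.

Definition sigma_channel (M : nat) (h : nat -> Omega -> 'I_M)
    (gamma : nat -> Omega -> bool) : set (set Omega) :=
  <<s [set E | (exists t i, E = [set omega | h t omega = i]) \/
               (exists t b, E = [set omega | gamma t omega = b])] >>.

(* The vectors w_0, w_1, ..., v_0, v_1, ... and the whole channel and dropout
   process form one mutually independent family. *)
Record gaussian_noises (n m M : nat) (W : 'M[R]_n) (V : 'M[R]_m)
    (w : nat -> Omega -> 'cV[R]_n) (v : nat -> Omega -> 'cV[R]_m)
    (h : nat -> Omega -> 'I_M) (gamma : nat -> Omega -> bool) : Prop :=
  { noise_W : psdmx W;
    noise_V : psdmx V;
    noise_w : forall t, centered_gaussian P W (w t);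
    noise_v : forall t, centered_gaussian P V (v t);
    noise_indep : mutually_independent P
      (fun k : option (nat + nat) =>
         match k with
         | Some (inl t) => sigma_vector (w t)
         | Some (inr t) => sigma_vector (v t)
         | None => sigma_channel h gamma
         end) }.

Fixpoint holding_time (gamma : nat -> Omega -> bool) (delta0 : nat) (t : nat)
    (omega : Omega) : nat :=
  match t with
  | 0 => delta0
  | u.+1 => if gamma u omega then 0%N
            else (holding_time gamma delta0 u omega).+1
  end.

Record remote_estimator (n : nat) (A : 'M[R]_n) (gamma : nat -> Omega -> bool)
    (xs xhat : nat -> Omega -> 'cV[R]_n) : Prop :=
  { re_init : random_vector (xhat 0%N);
    re_update : forall t omega,
      xhat t.+1 omega =
        if gamma t omega then A *m xs t omega else A *m xhat t omega }.

(* The recursion in closed form, from the first successful transmission on. *)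
Lemma remote_estimateE (n : nat) (A : 'M[R]_n) (gamma : nat -> Omega -> bool)
    (xs xhat : nat -> Omega -> 'cV[R]_n) (delta0 : nat) :
  remote_estimator A gamma xs xhat -> forall t omega,
  let delta := holding_time gamma delta0 t omega in (delta < t)%N ->
  xhat t omega = A ^+ delta.+1 *m xs (t - delta.+1)%N omega.
Proof.
move=> [_ H]; elim=> [//|t IH] omega /=; rewrite H.
case: (gamma t omega) => /= Hd; first by rewrite subSS subn0 expr1.
rewrite (IH omega); last by [].
by rewrite subSS (exprS A (_.+1)) mulmxA.
Qed.

Definition error_cov (n : nat) (A W Pbar0 : 'M[R]_n)
    (delta : nat -> Omega -> nat) (t : nat) (omega : Omega) : 'M[R]_n :=
  iter (delta t omega).+1 (predict_cov A W) Pbar0.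

(* The term of the sequence at T = 0 is 0 and does not affect the limsup. *)
Definition average_cost (n : nat) (A W Pbar0 : 'M[R]_n)
    (delta : nat -> Omega -> nat) : \bar R :=
  limn_esup (fun T : nat =>
    ((T%:R^-1)%:E *
     \sum_(1 <= t < T.+1)
        'E_P[fun omega => \tr (error_cov A W Pbar0 delta t omega)])%E).

Definition mean_square_stable (n : nat) (A W Pbar0 : 'M[R]_n)
    (delta : nat -> Omega -> nat) : Prop :=
  (average_cost A W Pbar0 delta < +oo)%E.

End RemoteEstimation.

(* Main.v *)
(* Write a = rho(A)^2 and B = D M. With mu_s the law of h_s, a run of k failures
   starting in slot s has probability mu_s B^k 1, so P[delta_t >= k] = mu_(t-k) B^k 1
   for k <= t. The trace of v^(k+1)(P_0) is at most c r^k for every r > a, while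
   the entries of B^k are at most c q^k for every q > rho(B); if a rho(B) < 1, choose
   r q < 1 and the expected costs are bounded by a geometric series.
   Conversely, Tr v^(k+1)(P_0) >= sum_(i <= k) w_i with w_i = Tr(A^i W (A^i)^T), so
   E[Tr P_t] >= sum_i w_i P[delta_t >= i]. By irreducibility, mu_s summed over a
   long enough window is bounded below by a constant in every state, hence a finite
   J bounds the series of the w_i (1^T B^i 1) >= w_i rho(B)^i. By
   controllability, n+1 consecutive w_i add up to at least a constant times a^i, so
   this series diverges when a rho(B) >= 1. *)
Require Import Defs.
From mathcomp Require Import all_boot all_order all_algebra.
From mathcomp Require Import complex ring lra.
From mathcomp Require Import all_classical all_reals all_analysis.
From mathcomp Require Import measurable_realfun.

Import Order.TTheory GRing.Theory Num.Theory.
Local Open Scope ring_scope.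

Set Implicit Arguments.
Unset Strict Implicit.
Unset Printing Implicit Defensive.

(** * Spectral radius and growth of matrix powers *)

Section SpectralRadius.

Lemma mulr_expmx (K : comNzRingType) (n k : nat) (X : 'M[K]_n) :
  X ^+ k.+1 = X *m X ^+ k.
Proof. exact: exprS. Qed.

(* Each factor X - a contributes the recurrence X^(k+1) Y = a X^k Y + X^k Y', where Y'
   is annihilated by the remaining factors. *)
Lemma prodB_recurrence_bound (K : numFieldType) (n : nat) (X : 'M[K]_n.+1)
    (r : K) (s : seq K) (Y : 'M[K]_n.+1) :
  0 < r -> {in s, forall a, `|a| < r} ->
  \prod_(a <- s) (X - a%:M) * Y = 0 ->
  exists2 c : K, 0 <= c & forall k i j, `|(X ^+ k * Y) i j| <= c * r ^+ k.
Proof.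
move=> r0; elim/last_ind: s Y => [|s a IH] Y sr.
  rewrite big_nil mul1r => ->; exists 0 => // k i j.
  by rewrite mulr0 mxE normr0 mul0r.
rewrite -cats1 big_cat big_seq1 /= -mulrA => /IH [|c c0 hc].
  by move=> b bs; apply: sr; rewrite mem_rcons inE bs orbT.
have ar : `|a| < r by apply: sr; rewrite mem_rcons inE eqxx.
have ra0 : 0 < r - `|a| by rewrite subr_gt0.
pose y := \sum_i \sum_j `|Y i j|.
have y0 : 0 <= y by apply: sumr_ge0 => i _; apply: sumr_ge0.
(* The summand [y] starts the induction at [k = 0]. The quotient [q] solves [|a| q + c = r q], so
   the recurrence reproduces it at each step. *)
exists (y + c / (r - `|a|)); first by rewrite addr_ge0// divr_ge0// ltW.
elim=> [|k IHk] i j.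
  rewrite expr0 mul1r mulr1 (le_trans (y := y))//; last first.
    by rewrite lerDl divr_ge0// ltW.
  rewrite /y (bigD1 i)//= (bigD1 j)//= -addrA lerDl addr_ge0//.
    exact: sumr_ge0.
  by apply: sumr_ge0 => ? _; apply: sumr_ge0.
have -> : X ^+ k.+1 * Y = a *: (X ^+ k * Y) + X ^+ k * ((X - a%:M) * Y).
  rewrite mulrBl mulrBr exprSr -mulrA -[a%:M * Y]/(a%:M *m Y) mul_scalar_mx.
  by rewrite -scalerAr addrC subrK.
have mxEaddZ (U Z : 'M[K]_n.+1) : (a *: U + Z) i j = a * U i j + Z i j.
  by rewrite !mxE.
rewrite mxEaddZ (le_trans (ler_normD _ _))// normrM.
apply: (le_trans (lerD (ler_wpM2l (normr_ge0 a) (IHk i j)) (hc k i j))).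
set q := c / _; have cE : c = q * (r - `|a|) by rewrite divfK// gt_eqF.
rewrite exprS !mulrA -mulrDl; apply: ler_wpM2r; first by rewrite exprn_ge0// ltW.
rewrite cE [leLHS](_ : _ = (y + q) * r - y * (r - `|a|)); last by ring.
by rewrite gerBl mulr_ge0// ltW.
Qed.

Variables (R : realType) (n : nat) (X : 'M[R]_n).
Local Notation toC := (real_complex R).
Local Notation XC := (map_mx toC X).

Let moduli := [set r : R | exists z : R[i], eigenvalue XC z /\ toC r = `|z|]%classic.

Lemma eigenvalue_modulus (z : R[i]) :
  eigenvalue XC z -> exists2 r, moduli r & toC r = `|z|.
Proof.
move=> ez; exists (Num.sqrt ((complex.Re z) ^+ 2 + (complex.Im z) ^+ 2)).
  by exists z; rewrite normc_def.
by rewrite normc_def.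
Qed.

Lemma norm_real_complex (r : R) : `|toC r| = toC `|r|.
Proof. by rewrite normc_def /= expr0n addr0 sqrtr_sqr. Qed.

(** A left eigenvector [u] for [z] is multiplied by [z ^+ k] under [X ^+ k]; compare the sums of
    moduli of the entries on both sides and divide by that of [u]. *)
Lemma eigenvalue_expmx_bound (z : R[i]) (k : nat) :
  eigenvalue XC z -> `|z| ^+ k <= toC (\sum_i \sum_j `|(X ^+ k) i j|).
Proof.
case/eigenvalueP => u uX u0.
have uXk : u *m map_mx toC (X ^+ k) = z ^+ k *: u.
  elim: k => [|k IH]; first by rewrite map_mx1 mulmx1 scale1r.
  by rewrite mulr_expmx map_mxM mulmxA uX -scalemxAl IH scalerA -exprS.
have [j uj0] : exists j, u 0 j != 0.
  apply: contrapT => /forallNP u0'; case/eqP: u0; apply/rowP => j.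
  by rewrite mxE; apply/eqP/negPn/negP/u0'.
pose s := \sum_j `|u 0 j|.
have s0 : 0 < s.
  rewrite /s (bigD1 j)//= ltr_wpDr ?normr_gt0//.
  exact: sumr_ge0.
rewrite -(ler_pM2r s0).
have -> : `|z| ^+ k * s = \sum_j `|(z ^+ k *: u) 0 j|.
  by rewrite mulr_sumr; apply: eq_bigr => l _; rewrite mxE normrM normrX.
rewrite -uXk.
apply: (le_trans (y := \sum_j \sum_l `|u 0 l| * `|toC ((X ^+ k) l j)|)).
  apply: ler_sum => l _; rewrite mxE (le_trans (ler_norm_sum _ _ _))//.
  by apply: ler_sum => p _; rewrite normrM !mxE.
rewrite exchange_big/= mulrC /s mulr_suml; apply: ler_sum => l _.
rewrite -mulr_sumr ler_wpM2l//.
rewrite [X in _ <= X](_ : _ = \sum_i \sum_p `|toC ((X ^+ k) i p)|); last first.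
  rewrite rmorph_sum; apply: eq_bigr => i _; rewrite rmorph_sum.
  by apply: eq_bigr => p _; rewrite norm_real_complex.
rewrite [X in _ <= X](bigD1 l)//= lerDl.
by apply: sumr_ge0 => i _; apply: sumr_ge0.
Qed.

Lemma moduli_ubound : has_ubound moduli.
Proof.
exists (\sum_i \sum_j `|(X ^+ 1) i j|) => r [z [ez rz]].
by rewrite -lecR -[X in X <= _]/(toC r) rz -[`|z|]expr1 eigenvalue_expmx_bound.
Qed.

Lemma eigenvalue_le_spectral_radius (z : R[i]) :
  eigenvalue XC z -> `|z| <= toC (spectral_radius X).
Proof.
move=> /eigenvalue_modulus[r hr <-]; rewrite lecR.
by apply: ub_le_sup => //; exact: moduli_ubound.
Qed.

Lemma spectral_radius_ge0 : 0 <= spectral_radius X.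
Proof.
have [h|h] := pselect (exists z, eigenvalue XC z).
  case: h => z ez; rewrite -ler0c.
  exact: le_trans (eigenvalue_le_spectral_radius ez).
rewrite /spectral_radius (_ : mkset _ = set0) ?sup0//.
by rewrite -subset0 => r [z [ez _]]; apply: h; exists z.
Qed.

(** Each eigenvalue modulus is at most the [k]-th root of the entry sum, so the supremum is too,
    whether or not it is attained. Positivity of the radius guarantees that an eigenvalue exists;
    the empty matrix with [k = 0] would violate the bound. *)
Lemma spectral_radius_exp_le (k : nat) :
  0 < spectral_radius X ->
  spectral_radius X ^+ k <= \sum_i \sum_j `|(X ^+ k) i j|.
Proof.
move=> rho0; set N := (X in _ <= X).
have [k0|k0] := posnP k.
  have : exists z, eigenvalue XC z.
    apply: contrapT => /forallNP h.
    move: rho0; rewrite /spectral_radius (_ : mkset _ = set0) ?sup0 ?ltxx//.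
    by rewrite -subset0 => r [z [/h]].
  by case=> z /(@eigenvalue_expmx_bound _ k); rewrite /N k0 !expr0 lecR.
have N0 : 0 <= N by apply: sumr_ge0 => i _; apply: sumr_ge0.
have kinv : 0 <= (k%:R^-1 : R) by rewrite invr_ge0.
have powK (a : R) : 0 <= a -> (a `^ k%:R^-1) ^+ k = a.
  by move=> a0; rewrite -powR_mulrn ?powR_ge0// -powRrM mulVf ?powRr1// pnatr_eq0 -lt0n.
rewrite -[N]powK// lerXn2r ?nnegrE ?powR_ge0 ?spectral_radius_ge0//.
apply: ge_sup.
  apply: contrapT => /nonemptyPn h; move: rho0.
  by rewrite (congr1 sup h : spectral_radius X = sup set0) sup0 ltxx.
move=> r [z [ez rz]].
have r0 : 0 <= r by rewrite -ler0c -/(toC r) rz.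
rewrite -(@ler_pXn2r _ k)// ?nnegrE ?powR_ge0// powK// -lecR.
by rewrite -[X in X <= _]/(toC (r ^+ k)) rmorphXn/= rz eigenvalue_expmx_bound.
Qed.
End SpectralRadius.

(** Over the complex numbers the characteristic polynomial splits, and by Cayley-Hamilton the
    product of the factors [XC - a%:M] over its roots vanishes. All roots have modulus below [r], so
    the recurrence bound applies with [Y = 1]. *)
Lemma expmx_spectral_bound (R : realType) (n : nat) (X : 'M[R]_n) (r : R) :
  spectral_radius X < r ->
  exists2 c : R, 0 <= c & forall k i j, `|(X ^+ k) i j| <= c * r ^+ k.
Proof.
case: n X => [|n] X rho_lt; first by exists 0 => // k [].
have r0 : 0 < r by apply: le_lt_trans rho_lt; exact: spectral_radius_ge0.
pose XC := map_mx (real_complex R) X.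
have [s hs] := closed_field_poly_normal (char_poly XC).
have monic_s : lead_coef (char_poly XC) = 1 by exact/monicP/char_poly_monic.
rewrite monic_s scale1r in hs.
have sr : {in s, forall a, `|a| < real_complex R r}.
  move=> a /= sa; apply: (@le_lt_trans _ _ (real_complex R (spectral_radius X))).
    by apply: eigenvalue_le_spectral_radius; rewrite eigenvalue_root_char hs root_prod_XsubC.
  by rewrite ltcR.
have prod0 : \prod_(a <- s) (XC - a%:M) * 1 = 0.
  rewrite mulr1 -(Cayley_Hamilton XC) hs rmorph_prod/=; apply: eq_bigr => a _.
  by rewrite rmorphB/= horner_mx_X horner_mx_C.
have rC0 : 0 < real_complex R r by rewrite ltcR.
have [c c0 hc] := prodB_recurrence_bound rC0 sr prod0.
(* The order on [R[i]] makes a nonnegative number real, so nothing is lost in passing to the real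
   part. *)
exists (complex.Re c) => [|k i j].
  by move: c0; rewrite lecE => /andP[].
have cE : c = real_complex R (complex.Re c).
  by rewrite RRe_real// ger0_real.
have := hc k i j; rewrite mulr1.
have -> : c * real_complex R r ^+ k = real_complex R (complex.Re c * r ^+ k).
  by rewrite rmorphM rmorphXn/= {1}cE.
have -> : (XC ^+ k) i j = real_complex R ((X ^+ k) i j).
  by rewrite /XC -rmorphXn mxE.
by rewrite norm_real_complex lecR.
Qed.

(** * Growth of the trace of the error covariance *)

Section ErrorCovariance.
Variables (R : realType) (n : nat).
Implicit Types A W X S : 'M[R]_n.

Lemma iter_predict_cov A W X k :
  iter k (predict_cov A W) X =
  A ^+ k *m X *m (A ^+ k)^T + \sum_(i < k) A ^+ i *m W *m (A ^+ i)^T.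
Proof.
elim: k => [|k IH].
  by rewrite big_ord0 addr0 expr0 mul1mx trmx1 mulmx1.
rewrite iterS IH /predict_cov mulmxDr mulmxDl -addrA; congr (_ + _).
  by rewrite mulr_expmx trmx_mul !mulmxA.
rewrite big_ord_recl expr0 mul1mx trmx1 mulmx1 addrC; congr (_ + _).
rewrite mulmx_sumr mulmx_suml; apply: eq_bigr => i _.
by rewrite lift0 mulr_expmx trmx_mul !mulmxA.
Qed.

Lemma mxtrace_congr_ge0 (p : nat) (B : 'M[R]_(p, n)) X :
  psdmx X -> 0 <= \tr (B *m X *m B^T).
Proof.
move=> [_ hX]; apply: sumr_ge0 => i _.
have -> : (B *m X *m B^T) i i = ((row i B)^T^T *m X *m (row i B)^T) 0 0.
  by rewrite trmxK -row_mul !mxE; apply: eq_bigr => j _; rewrite !mxE.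
exact: hX.
Qed.

(** For the noise covariance [W] this is the contribution of noise propagated for [i] steps; for
    [Pbar0] it is the contribution of the initial error. *)
Definition noise_gain A W (i : nat) : R := \tr (A ^+ i *m W *m (A ^+ i)^T).

Lemma noise_gain_ge0 A W i : psdmx W -> 0 <= noise_gain A W i.
Proof. exact: mxtrace_congr_ge0. Qed.

Lemma mxtrace_iter_predict_cov A W X k :
  \tr (iter k (predict_cov A W) X) = noise_gain A X k + \sum_(i < k) noise_gain A W i.
Proof. by rewrite iter_predict_cov mxtraceD raddf_sum. Qed.

(** The trace is quadratic in [A ^+ k], so the entries of the power are bounded at rate
    [Num.sqrt r], which still exceeds the spectral radius. *)
Lemma noise_gain_le A X (r : R) : 0 <= r -> spectral_radius A ^+ 2 < r ->
  exists2 c : R, 0 <= c & forall k, noise_gain A X k <= c * r ^+ k.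
Proof.
move=> r0 rho_lt.
have rhos : spectral_radius A < Num.sqrt r.
  by rewrite -(ger0_norm (spectral_radius_ge0 A)) -sqrtr_sqr ltr_sqrt// (le_lt_trans _ rho_lt)// sqr_ge0.
have [c c0 hc] := expmx_spectral_bound rhos.
exists (c ^+ 2 * \sum_(i < n) \sum_(j < n) \sum_(p < n) `|X p j|).
  rewrite mulr_ge0 ?sqr_ge0//; do 3!apply: sumr_ge0 => ? _.
  exact: normr_ge0.
move=> k; rewrite mulrAC mulr_sumr; apply: ler_sum => i _.
rewrite !mxE mulr_sumr; apply: ler_sum => j _.
rewrite !mxE mulr_suml mulr_sumr; apply: ler_sum => p _.
apply: (le_trans (ler_norm _)); rewrite !normrM.
apply: (le_trans (y := c * Num.sqrt r ^+ k * `|X p j| * (c * Num.sqrt r ^+ k))).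
  by rewrite ler_pM// ?mulr_ge0// ler_wpM2r.
rewrite le_eqVlt; apply/orP; left; apply/eqP.
rewrite -[in RHS](sqr_sqrtr r0) -exprM mulnC exprM.
by ring.
Qed.

Lemma mxtrace_iter_predict_cov_le A W X (r : R) :
  1 < r -> spectral_radius A ^+ 2 < r ->
  exists2 c : R, 0 <= c &
    forall k, \tr (iter k (predict_cov A W) X) <= c * r ^+ k.
Proof.
move=> r1 rho_lt; have r0 : 0 <= r by rewrite ltW// (lt_trans _ r1).
have rm0 : 0 < r - 1 by rewrite subr_gt0.
have [c c0 hc] := noise_gain_le X r0 rho_lt.
have [b b0 hb] := noise_gain_le W r0 rho_lt.
(* The constant [b / (r - 1)] bounds the geometric sum of the noise terms: it solves [q + b = q r].
   This is where [1 < r] is needed. *)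
exists (c + b / (r - 1)) => [|k]; first by rewrite addr_ge0// divr_ge0// ltW.
rewrite mxtrace_iter_predict_cov mulrDl lerD//.
elim: k => [|k IH]; first by rewrite big_ord0 mulr1 divr_ge0// ltW.
rewrite big_ord_recr/= (le_trans (lerD IH (hb k)))// le_eqVlt; apply/orP; left.
by rewrite exprS; apply/eqP; field; rewrite gt_eqF.
Qed.

(** Cauchy-Schwarz against the constant family: the double sum of [(x i - x j) ^+ 2] is nonnegative
    and is twice the difference of the two sides. *)
Lemma sqr_sum_le (I : finType) (x : I -> R) :
  (\sum_i x i) ^+ 2 <= #|I|%:R * \sum_i x i ^+ 2.
Proof.
have h : 0 <= \sum_i \sum_j (x i - x j) ^+ 2.
  by do 2!apply: sumr_ge0 => ? _; exact: sqr_ge0.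
suff E : \sum_i \sum_j (x i - x j) ^+ 2 =
    (#|I|%:R * (\sum_i x i ^+ 2) - (\sum_i x i) ^+ 2) *+ 2.
  by rewrite E pmulrn_lge0// subr_ge0 in h.
have -> : \sum_i \sum_j (x i - x j) ^+ 2 =
    \sum_i (#|I|%:R * x i ^+ 2 + \sum_j x j ^+ 2 - (x i * \sum_j x j) *+ 2).
  apply: eq_bigr => i _.
  rewrite mulr_natl -sumr_const mulr_sumr -sumrMnl -big_split/= -sumrB.
  by apply: eq_bigr => j _; ring.
rewrite sumrB big_split/= -mulr_sumr sumr_const sumrMnl -mulr_suml -mulr_natl.
ring.
Qed.

(** The controllability matrix has a right inverse, with blocks [N l], so [A ^+ k] is the sum of the
    [A ^+ (k + l) *m S *m N l]. Hence the entries of [A ^+ k], and with them the [k]-th power of the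
    spectral radius, are controlled by those of the matrices [A ^+ (k + l) *m S], whose squares add
    up to noise gains. *)
Lemma controllable_spectral_radius_le A S W :
  is_sqrtmx S W -> controllable A S -> 0 < spectral_radius A ->
  exists2 c : R, 0 < c & forall k,
    (spectral_radius A ^+ 2) ^+ k <= c * \sum_(l < n.+1) noise_gain A W (k + l).
Proof.
move=> [[Ssym _] SW] ctr rho0.
set U := (\mxrow_(k < n.+1) (A ^+ k *m S)) in ctr.
have U1 : U *m pinvmx U = 1%:M by apply: mulmxVp; apply/eqP.
pose N := submxcol (pinvmx U).
have decomp k : A ^+ k = \sum_(l < n.+1) A ^+ (k + l) *m S *m N l.
  rewrite -[LHS]mulmx1 -U1 -[pinvmx U]submxcolK mul_mxrow_mxcol mulmx_sumr.
  by apply: eq_bigr => l _; rewrite (exprD A) !mulmxA.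
pose T := ('I_n.+1 * ('I_n * 'I_n))%type.
(* All entries of the [n.+1] matrices are put in one family over [T], so that Cauchy-Schwarz is
   applied only once. *)
pose f k (t : T) := `|(A ^+ (k + t.1) *m S) t.2.1 t.2.2|.
pose c := \sum_(j < n) \sum_(l < n.+1) \sum_(p < n) `|N l p j|.
have c0 : 0 <= c by do 3!apply: sumr_ge0 => ? _.
have gainE k : \sum_(l < n.+1) noise_gain A W (k + l) = \sum_t f k t ^+ 2.
  rewrite -(pair_bigA _ (fun l t => f k (l, t) ^+ 2))/=; apply: eq_bigr => l _.
  rewrite -(pair_bigA _ (fun i p => f k (l, (i, p)) ^+ 2))/=.
  rewrite /noise_gain -SW.
  rewrite [X in \tr X](_ : _ = (A ^+ (k + l) *m S) *m (A ^+ (k + l) *m S)^T); last first.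
    by rewrite trmx_mul Ssym !mulmxA.
  apply: eq_bigr => i _; rewrite [LHS]mxE; apply: eq_bigr => p _.
  by rewrite [X in _ * X]mxE -expr2 /f/= real_normK// num_real.
have entries k : \sum_i \sum_j `|(A ^+ k) i j| <= c * \sum_t f k t.
  rewrite exchange_big/= mulr_suml; apply: ler_sum => j _.
  have -> : \sum_t f k t = \sum_l \sum_i \sum_p f k (l, (i, p)).
    rewrite -(pair_bigA _ (fun l t => f k (l, t)))/=; apply: eq_bigr => l _.
    by rewrite -(pair_bigA _ (fun i p => f k (l, (i, p)))).
  apply: (le_trans (y := \sum_i \sum_l \sum_p f k (l, (i, p)) * `|N l p j|)).
    apply: ler_sum => i _; rewrite decomp summxE.
    apply: (le_trans (ler_norm_sum _ _ _)); apply: ler_sum => l _.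
    rewrite mxE; apply: (le_trans (ler_norm_sum _ _ _)); apply: ler_sum => p _.
    by rewrite normrM.
  rewrite exchange_big/= mulr_suml; apply: ler_sum => l _.
  apply: (le_trans (y := (\sum_p `|N l p j|) * \sum_i \sum_p f k (l, (i, p)))).
    rewrite exchange_big/= [X in _ <= _ * X]exchange_big/= mulr_suml.
    apply: ler_sum => p _; rewrite -mulr_suml mulrC ler_wpM2l//.
    rewrite [leRHS](bigD1 p)//= lerDl.
    by do 2!apply: sumr_ge0 => ? _; exact: normr_ge0.
  rewrite ler_wpM2l ?sumr_ge0// (bigD1 l)//= lerDl.
  by do 3!apply: sumr_ge0 => ? _; exact: normr_ge0.
(* The factor [#|T|] comes from Cauchy-Schwarz; the added 1 makes positivity of the constant
   immediate. *)
exists (c ^+ 2 * #|{: T}|%:R + 1); first by rewrite ltr_wpDl// mulr_ge0// sqr_ge0.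
move=> k; rewrite gainE -exprM mulnC exprM.
apply: (le_trans (y := (c * \sum_t f k t) ^+ 2)).
  apply: lerXn2r; rewrite ?nnegrE.
  - by rewrite exprn_ge0// spectral_radius_ge0.
  - by rewrite mulr_ge0// sumr_ge0// => *; exact: normr_ge0.
  exact: le_trans (spectral_radius_exp_le k rho0) (entries k).
rewrite exprMn mulrDl mul1r ler_wpDr//.
  by rewrite sumr_ge0// => *; rewrite sqr_ge0.
by rewrite -[_ * _%:R * _]mulrA; apply: ler_wpM2l; rewrite ?sqr_ge0// sqr_sum_le.
Qed.

End ErrorCovariance.

(** * Joint law of the channel states and the dropouts *)

Section Channel.
Local Open Scope classical_set_scope.
Context (R : realType) (disp : measure_display) (Omega : measurableType disp).
Variable P : probability Omega R.
Implicit Types E F : set Omega.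

Lemma prob_ge0 E : 0 <= prob P E.
Proof. exact: fine_ge0. Qed.

Lemma le_prob E F : measurable E -> measurable F -> E `<=` F -> prob P E <= prob P F.
Proof.
move=> mE mF EF; apply: fine_le; rewrite ?fin_num_measure//.
by apply: le_measure; rewrite ?inE.
Qed.

Lemma probT : prob P setT = 1.
Proof. by rewrite /prob probability_setT. Qed.

Lemma prob_setU E F : measurable E -> measurable F -> E `&` F = set0 ->
  prob P (E `|` F) = prob P E + prob P F.
Proof.
move=> mE mF EF; rewrite /prob measureU// fineD//.
  by rewrite fin_num_measure.
by rewrite fin_num_measure.
Qed.

Lemma prob_eq0_sub E F : measurable E -> measurable F -> E `<=` F ->
  prob P F = 0 -> prob P E = 0.
Proof.
move=> mE mF EF F0; apply/eqP; rewrite eq_le prob_ge0 andbT -F0.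
exact: le_prob.
Qed.

Lemma prob_sum_fiber (I : finType) (X : Omega -> I) E :
  measurable E -> (forall i, measurable [set w | X w = i]) ->
  prob P E = \sum_i prob P (E `&` [set w | X w = i]).
Proof.
move=> mE mX.
suff H (s : seq I) : uniq s ->
    measurable (E `&` [set w | X w \in s]) /\
    prob P (E `&` [set w | X w \in s]) = \sum_(i <- s) prob P (E `&` [set w | X w = i]).
  have [_ <-] := H _ (index_enum_uniq I); congr prob.
  by apply/seteqP; split => [w Ew|w []//]; split => //=; rewrite mem_index_enum.
elim: s => [_|i s IH /= /andP[nis us]].
  rewrite big_nil (_ : _ `&` _ = set0).
    by split; [exact: measurable0 | rewrite /prob measure0].
  by apply/seteqP; split => [w [] //|//].
have [ms es] := IH us.
have mi : measurable (E `&` [set w | X w = i]) by exact: measurableI.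
have -> : E `&` [set w | X w \in i :: s] =
    (E `&` [set w | X w = i]) `|` (E `&` [set w | X w \in s]).
  rewrite -setIUr; congr (_ `&` _); apply/seteqP; split=> w /=.
    by rewrite inE => /orP[/eqP|]; [left|right].
  by rewrite inE; case=> [/eqP|] ->; rewrite ?orbT.
split; first exact: measurableU.
rewrite big_cons prob_setU ?es//.
apply/seteqP; split=> // w [[_ /= Xo] [_]] /=.
by rewrite Xo (negbTE nis).
Qed.

Context (M : nat) (Pi : 'M[R]_M) (d : 'rV[R]_M).
Context (h : nat -> Omega -> 'I_M) (gamma : nat -> Omega -> bool).
Hypothesis hch : markov_fading_channel P Pi d h gamma.

Definition states_eq (t : nat) (s : nat -> 'I_M) : set Omega :=
  [set w | forall u, (u <= t)%N -> h u w = s u].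

(** The predicate [S] leaves some slots free, and slot [t] itself is excluded: its outcome is
    accounted for together with the transition to [t.+1]. *)
Definition outcomes_eq (t : nat) (S : pred nat) (g : nat -> bool) : set Omega :=
  [set w | forall u, (u < t)%N -> S u -> gamma u w = g u].

Lemma measurable_states_eq t s : measurable (states_eq t s).
Proof.
rewrite (_ : states_eq _ _ = \bigcap_(u in [set u | (u <= t)%N]) [set w | h u w = s u]).
  by apply: bigcap_measurableType => u _; exact: ch_measurable hch _ _.
by apply/seteqP; split.
Qed.

Lemma measurable_outcomes_eq t S g : measurable (outcomes_eq t S g).
Proof.
rewrite (_ : outcomes_eq _ _ _ =
    \bigcap_(u in [set u | (u < t)%N /\ S u]) [set w | gamma u w = g u]).
  by apply: bigcap_measurableType => u _; exact: ch_gamma_measurable hch _ _.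
apply/seteqP; split => [w H u [/= ut Su]|w H u ut Su]; first exact: H.
exact: H.
Qed.

Let mSO t s k S g : measurable (states_eq t s `&` outcomes_eq k S g).
Proof. by apply: measurableI; [exact: measurable_states_eq|exact: measurable_outcomes_eq]. Qed.

Lemma cprob_outcome_sum1 u i : prob P [set w | h u w = i] != 0 ->
  cprob P [set w | gamma u w = true] [set w | h u w = i] +
  cprob P [set w | gamma u w = false] [set w | h u w = i] = 1.
Proof.
move=> h0; rewrite /cprob -mulrDl -[in RHS](divff h0); congr (_ / _).
rewrite [RHS](@prob_sum_fiber bool (gamma u)).
- rewrite big_bool; congr (_ + _); by rewrite setIC.
- exact: ch_measurable hch _ _.
- by move=> b; exact: ch_gamma_measurable hch _ _.
Qed.

Let cgamma (g : nat -> bool) (s : nat -> 'I_M) (u : nat) :=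
  cprob P [set w | gamma u w = g u] [set w | h u w = s u].

Lemma states_fiber_neq0 t s u : (u <= t)%N -> prob P (states_eq t s) != 0 ->
  prob P [set w | h u w = s u] != 0.
Proof.
move=> ut; apply: contraNneq => h0; apply/eqP/(prob_eq0_sub _ _ _ h0).
- exact: measurable_states_eq.
- exact: ch_measurable hch _ _.
- by move=> w; apply.
Qed.

(* Induction on the number N of leading outcomes summed out. *)
Lemma prob_states_outcomes t s (T : pred nat) g :
  prob P (states_eq t s `&` outcomes_eq t.+1 T g) =
  prob P (states_eq t s) * \prod_(u < t.+1) (if T u then cgamma g s u else 1).
Proof.
(* On a path of probability 0 no conditional probability is prescribed, but both sides vanish. *)
have [p0|pn0] := eqVneq (prob P (states_eq t s)) 0.
  rewrite p0 mul0r; apply: prob_eq0_sub p0 => //; first exact: measurable_states_eq.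
(* Slots from [N] on stay constrained in addition to those in [T]: [N = 0] is the conditional
   independence hypothesis, [N = t.+1] the claim. The sequence [g] is generalized because the
   induction step changes it at [N]. *)
suff H N : forall g, prob P (states_eq t s `&` outcomes_eq t.+1 (fun u => T u || (N <= u)%N) g) =
    prob P (states_eq t s) *
      \prod_(u < t.+1) (if T u || (N <= u)%N then cgamma g s u else 1).
  have := H t.+1 g; congr (prob P (_ `&` _) = _ * _).
    by apply/seteqP; split=> w hw u ut Tu; apply: hw => //; move: Tu; rewrite leqNgt ut orbF.
  by apply: eq_bigr => u _; rewrite leqNgt ltn_ord orbF.
elim: N => [|N IH] {}g.
  have := ch_drop_indep hch (t := t) (s := s) g pn0.
  rewrite /cprob => /(canRL (divfK pn0)); rewrite [X in _ = X -> _]mulrC => E.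
  rewrite [in LHS]setIC; under eq_bigr do rewrite orbT.
  rewrite -E; congr (prob P (_ `&` _)).
  by apply/seteqP; split=> w hw u ut; [apply: hw; rewrite ?orbT|move=> _; exact: hw].
(* If slot [N] is in [T] or lies beyond [t], releasing it changes neither side. *)
have [TN|TN] := boolP (T N || (t < N)%N).
  have TE u : (u < t.+1)%N -> T u || (N < u)%N = T u || (N <= u)%N.
    move=> ut; rewrite [in RHS]leq_eqVlt; case: eqP => [uN|//].
    by move: TN ut; rewrite uN ltnn => /orP[->//|tu]; rewrite ltnS leqNgt tu.
  have := IH g; congr (prob P (_ `&` _) = _ * _).
    by apply/seteqP; split=> w hw u ut; move: (hw u ut); rewrite TE.
  by apply: eq_bigr => u _; rewrite TE.
move: TN; rewrite negb_or -leqNgt => /andP[nTN Nt].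
(* Otherwise split by the outcome [b] of slot [N]. Each case is the induction hypothesis for [gN b],
   and the two factors of slot [N] add up to 1. *)
pose gN b u := if u == N then b else g u.
have hN : prob P [set w | h N w = s N] != 0 by exact: states_fiber_neq0 pn0.
rewrite (@prob_sum_fiber bool (gamma N))//; last first.
  by move=> b; exact: ch_gamma_measurable hch _ _.
have step b : prob P (states_eq t s `&` outcomes_eq t.+1 (fun u => T u || (N < u)%N) g
      `&` [set w | gamma N w = b]) =
    prob P (states_eq t s) *
      \prod_(u < t.+1) (if T u || (N < u)%N then cgamma g s u else 1) *
      cprob P [set w | gamma N w = b] [set w | h N w = s N].
  rewrite -setIA -mulrA.
  have := IH (gN b); congr (prob P (_ `&` _) = _ * _).
    apply/seteqP; split=> w.
      move=> hw; split => [u ut Tu|/=].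
        have := hw u ut; rewrite /gN; case: eqP Tu => [->|_ Tu].
          by rewrite (negbTE nTN) ltnn.
        by apply; case/orP: Tu => [->//|/ltnW ->]; rewrite orbT.
      by have := hw N; rewrite /gN eqxx leqnn orbT; apply.
    case=> hw /= hNb u ut; rewrite /gN; case: eqP => [->//|/eqP uN].
    by rewrite leq_eqVlt eq_sym (negbTE uN); exact: hw.
  rewrite (bigD1 (Ordinal (Nt : (N < t.+1)%N)))//= leqnn orbT mulrC.
  rewrite [in RHS](bigD1 (Ordinal (Nt : (N < t.+1)%N)))//= ltnn (negbTE nTN) mul1r.
  congr (_ * _); last by rewrite /cgamma /gN eqxx.
  apply: eq_bigr => u /eqP uN; have uN' : (u : nat) != N.
    by apply/eqP => uN'; apply: uN; exact: val_inj.
  by rewrite /cgamma /gN (negbTE uN') [(N <= u)%N]leq_eqVlt eq_sym (negbTE uN').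
by rewrite big_bool/= !step -mulrDr cprob_outcome_sum1// mulr1.
Qed.

Definition failures (t : nat) (S : pred nat) := outcomes_eq t S (fun=> false).

Lemma measurable_failures t S : measurable (failures t S).
Proof. exact: measurable_outcomes_eq. Qed.

Lemma prob_states_failures t s S k : (k <= t.+1)%N ->
  prob P (states_eq t s `&` failures k S) =
  prob P (states_eq t s) * \prod_(0 <= u < k) (if S u then d 0 (s u) else 1).
Proof.
move=> kt.
have -> : failures k S = outcomes_eq t.+1 (fun u => S u && (u < k)%N) (fun=> false).
  apply/seteqP; split=> w hw u ut; first by case/andP; move=> *; exact: hw.
  by move=> Su; apply: hw; rewrite ?Su ?ut ?(leq_trans ut).
rewrite prob_states_outcomes.
have [->|pn0] := eqVneq (prob P (states_eq t s)) 0; first by rewrite !mul0r.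
congr (_ * _).
rewrite -(big_mkord xpredT (fun u => if S u && (u < k)%N then cgamma (fun=> false) s u else 1)).
rewrite (big_cat_nat (leq0n k) kt)//= [X in _ * X]big_nat_cond [X in _ * X]big1 ?mulr1; last first.
  by move=> u /andP[/andP[ku _] _]; rewrite [(u < k)%N]ltnNge ku andbF.
rewrite big_nat_cond [RHS]big_nat_cond; apply: eq_bigr => u /andP[/andP[_ uk] _].
rewrite uk andbT; case: ifP => // _; apply: ch_drop hch _ _ _.
by apply: states_fiber_neq0 pn0; rewrite -ltnS (leq_trans uk).
Qed.

Lemma prob_statesS t s :
  prob P (states_eq t.+1 s) = prob P (states_eq t s) * Pi (s t) (s t.+1).
Proof.
have E : states_eq t.+1 s = [set w | h t.+1 w = s t.+1] `&` states_eq t s.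
  apply/seteqP; split=> w.
    by move=> hw; split; [exact: hw|move=> u ut; apply: hw; rewrite leqW].
  by case=> /= h1 h2 u; rewrite leq_eqVlt => /orP[/eqP->//|]; rewrite ltnS; exact: h2.
have [p0|pn0] := eqVneq (prob P (states_eq t s)) 0.
  rewrite p0 mul0r; apply: prob_eq0_sub p0; try exact: measurable_states_eq.
  by rewrite E => w [].
have := ch_markov hch (s t.+1) pn0; rewrite -/(states_eq t s) /cprob -E => <-.
by rewrite mulrC divfK.
Qed.

(** The drop factor belongs to the state that is left, before the transition factor; summed over
    paths this order yields [diag_mx d *m Pi]. *)
Lemma prob_states_failuresS t s S :
  prob P (states_eq t.+1 s `&` failures t.+1 S) =
  prob P (states_eq t s `&` failures t S) * (if S t then d 0 (s t) else 1) * Pi (s t) (s t.+1).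
Proof.
rewrite !prob_states_failures// prob_statesS big_nat_recr//=.
by rewrite !mulrA; ring.
Qed.

(** An unnormalized law: its entries add up to the probability of the failures, and it evolves
    linearly in [t]. *)
Definition failure_law (t : nat) (S : pred nat) : 'rV[R]_M :=
  \row_j prob P (failures t S `&` [set w | h t w = j]).

(** The channel hypotheses condition on whole state histories, so the event is split along all paths
    up to [t], the one-step recursion is applied on each, and the paths are summed again with the
    state at time [t] fixed. *)
Lemma failure_lawS t S : failure_law t.+1 S =
  failure_law t S *m (if S t then diag_mx d *m Pi else Pi).
Proof.
pose path (w : Omega) : {ffun 'I_t.+1 -> 'I_M} := [ffun u : 'I_t.+1 => h u w].
(* Turns a path up to [t], followed by [j], into a sequence on [nat]; values after [t.+1] are junk
   that [states_eq] does not look at. *)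
pose ext (f : {ffun 'I_t.+1 -> 'I_M}) j u := if u == t.+1 then j else f (inord u).
have pathE f j : [set w | path w = f] = states_eq t (ext f j).
  apply/seteqP; split=> w.
    move=> /= <- u ut; rewrite /ext /path ffunE inordK ?ltnS//.
    by case: eqP => // ue; rewrite ue ltnn in ut.
  move=> hw; apply/ffunP => u; have ut : (u <= t)%N by rewrite -ltnS.
  rewrite ffunE hw// /ext inord_val.
  by case: eqP => // ue; have := ltn_ord u; rewrite ue ltnn.
have mpath f : measurable [set w | path w = f].
  rewrite (pathE f (f ord0)); exact: measurable_states_eq.
have mh u i : measurable [set w | h u w = i] by exact: ch_measurable hch _ _.
pose e i : R := if S t then d 0 i else 1.
apply/rowP => j; rewrite [LHS]mxE.
rewrite (@prob_sum_fiber _ path)//; last first.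
  by apply: measurableI => //; exact: measurable_failures.
have -> : (failure_law t S *m (if S t then diag_mx d *m Pi else Pi)) 0 j =
    \sum_i failure_law t S 0 i * (e i * Pi i j).
  rewrite mxE; apply: eq_bigr => i _; congr (_ * _).
  by rewrite /e; case: (S t); rewrite ?mul1r// mul_diag_mx mxE.
(* The inner sum has one nonzero term, at the last state of [f]; inserting it allows the sums over
   paths and states to be exchanged. *)
transitivity (\sum_f \sum_i
    prob P (failures t S `&` [set w | h t w = i] `&` [set w | path w = f]) * (e i * Pi i j)).
  apply: eq_bigr => f _.
  have ext_t : ext f j t = f ord_max.
    rewrite /ext ltn_eqF//; congr (f _).
    by apply: val_inj; rewrite /= inordK.
  have -> : failures t.+1 S `&` [set w | h t.+1 w = j] `&` [set w | path w = f] =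
      states_eq t.+1 (ext f j) `&` failures t.+1 S.
    rewrite (pathE f j) -setIA setIC; congr (_ `&` _); apply/seteqP; split=> w.
      case=> /= h1 h2 u; rewrite leq_eqVlt => /orP[/eqP->|]; last by rewrite ltnS; exact: h2.
      by rewrite /ext eqxx.
    by move=> hw; split => [/=|u ut]; [rewrite hw// /ext eqxx|apply: hw; rewrite leqW].
  rewrite prob_states_failuresS ext_t (bigD1 (f ord_max))//= big1 ?addr0.
    rewrite -mulrA /ext eqxx -/(e _); congr (prob P _ * _).
    rewrite setIC -setIA; congr (_ `&` _); rewrite (pathE f j).
    apply/seteqP; split=> w; last by case.
    by move=> hw; split=> //=; rewrite hw.
  move=> i ni; rewrite (_ : _ `&` _ = set0) ?[prob P set0]/prob ?measure0 ?mul0r//.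
  apply/seteqP; split=> // w [[_ /= hi] pf]; move: ni.
  by rewrite -hi -pf /path ffunE eqxx.
rewrite exchange_big/=; apply: eq_bigr => i _.
rewrite -mulr_suml mxE -prob_sum_fiber//.
by apply: measurableI => //; exact: measurable_failures.
Qed.

Definition state_law (t : nat) : 'rV[R]_M := \row_j prob P [set w | h t w = j].

Lemma failure_law_none t S : (forall u, (u < t)%N -> ~~ S u) ->
  failure_law t S = state_law t.
Proof.
move=> nS; apply/rowP => j; rewrite !mxE; congr prob.
rewrite (_ : failures t S = setT) ?setTI//; apply/seteqP; split=> // w _ u ut Su.
by case/negP: (nS u ut).
Qed.

Lemma state_lawS t : state_law t.+1 = state_law t *m Pi.
Proof. by rewrite -!(@failure_law_none _ xpred0)// failure_lawS. Qed.

Lemma state_lawD t k : state_law (t + k) = state_law t *m Pi ^+ k.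
Proof.
elim: k => [|k IH]; first by rewrite addn0 expr0 mulmx1.
by rewrite addnS state_lawS IH exprSr mulmxA.
Qed.

Lemma state_law_ge0 t j : 0 <= state_law t 0 j.
Proof. by rewrite mxE prob_ge0. Qed.

Lemma state_law_sum1 t : \sum_j state_law t 0 j = 1.
Proof.
rewrite -probT (@prob_sum_fiber _ (h t))//; last by move=> j; exact: ch_measurable hch _ _.
by apply: eq_bigr => j _; rewrite mxE setTI.
Qed.

(** Up to slot [s] nothing is constrained and the vector is the state law; each of the next [k]
    slots multiplies it by [diag_mx d *m Pi]. *)
Lemma prob_failure_run s k :
  prob P (failures (s + k) (fun u => (s <= u)%N)) =
  \sum_j (state_law s *m (diag_mx d *m Pi) ^+ k) 0 j.
Proof.
have -> : state_law s *m (diag_mx d *m Pi) ^+ k = failure_law (s + k) (fun u => (s <= u)%N).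
  elim: k => [|k IH].
    by rewrite addn0 expr0 mulmx1 failure_law_none// => u; rewrite -ltnNge.
  by rewrite addnS failure_lawS leq_addr -IH exprSr !mulmxA.
rewrite (@prob_sum_fiber _ (h (s + k))).
- by apply: eq_bigr => j _; rewrite mxE.
- exact: measurable_failures.
- by move=> j; exact: ch_measurable hch _ _.
Qed.

End Channel.

(** * Uniform occupation of all states over a finite window *)

Section Irreducibility.
Variables (R : realType) (M : nat) (Pi : 'M[R]_M).

Lemma expmx_ge0 (B : 'M[R]_M) : (forall i j, 0 <= B i j) -> forall k i j, 0 <= (B ^+ k) i j.
Proof.
move=> B0; elim=> [|k IH] i j; first by rewrite expr0 mxE ler0n.
by rewrite mulr_expmx mxE sumr_ge0// => l _; rewrite mulr_ge0.
Qed.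

(** For each pair of states choose a time with positive transition probability. The window reaches
    the latest of these times, and [eta] lies below all the chosen probabilities, so the bound holds
    for every initial law [mu]. *)
Lemma irreducible_window_ge : (forall i j, 0 <= Pi i j) -> irreducible_chain Pi ->
  exists K, exists2 eta : R, 0 < eta &
    forall (mu : 'rV[R]_M) j, (forall i, 0 <= mu 0 i) -> \sum_i mu 0 i = 1 ->
      eta <= \sum_(k < K.+1) (mu *m Pi ^+ k) 0 j.
Proof.
move=> Pi0 irr.
have /choice[kk hk] : forall t : 'I_M * 'I_M, exists k, 0 < (Pi ^+ k) t.1 t.2.
  by move=> [i j]; have [k _ hk] := irr i j; exists k.
pose x t := (Pi ^+ kk t) t.1 t.2.
have xV0 : 0 <= \sum_t (x t)^-1 by apply: sumr_ge0 => t _; rewrite invr_ge0 ltW// hk.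
have tot0 : 0 < 1 + \sum_t (x t)^-1 by rewrite ltr_pwDl.
(* The reciprocal of [1 + \sum_t (x t)^-1] replaces the minimum of the [x t]; the 1 keeps it
   positive for an empty index set. *)
exists (\max_t kk t); exists (1 + \sum_t (x t)^-1)^-1; first by rewrite invr_gt0.
move=> mu j mu0 mu1; set eta := _^-1.
have eta_le t : eta <= x t.
  rewrite -[x t]invrK lef_pV2 ?posrE ?invr_gt0 ?hk// (bigD1 t)//= addrCA lerDl addr_ge0//.
  by apply: sumr_ge0 => s _; rewrite invr_ge0 ltW// hk.
apply: (le_trans (y := \sum_i mu 0 i * x (i, j))).
  rewrite -[eta]mul1r -mu1 mulr_suml; apply: ler_sum => i _.
  by rewrite ler_wpM2l.
have -> : \sum_(k < (\max_t kk t).+1) (mu *m Pi ^+ k) 0 j =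
    \sum_i mu 0 i * \sum_(k < (\max_t kk t).+1) (Pi ^+ k) i j.
  rewrite (eq_bigr (fun k : 'I__ => \sum_i mu 0 i * (Pi ^+ k) i j)); last first.
    by move=> k _; rewrite mxE.
  by rewrite exchange_big/=; apply: eq_bigr => i _; rewrite mulr_sumr.
apply: ler_sum => i _; apply: ler_wpM2l => //.
have kb : (kk (i, j) < (\max_t kk t).+1)%N by rewrite ltnS leq_bigmax.
rewrite (bigD1 (Ordinal kb))//= lerDl.
by apply: sumr_ge0 => k _; exact: expmx_ge0.
Qed.

End Irreducibility.

(** * Tails and expectations of the holding time *)

Section HoldingTime.
Local Open Scope classical_set_scope.
Context (R : realType) (disp : measure_display) (Omega : measurableType disp).
Variable P : probability Omega R.
Context (M : nat) (Pi : 'M[R]_M) (d : 'rV[R]_M).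
Context (h : nat -> Omega -> 'I_M) (gamma : nat -> Omega -> bool) (delta0 : nat).
Hypothesis hch : markov_fading_channel P Pi d h gamma.
Local Notation delta := (holding_time gamma delta0).

Lemma holding_time_le t w : (delta t w <= t + delta0)%N.
Proof.
by elim: t => [|t IH] //=; case: (gamma t w) => //; rewrite addSn ltnS.
Qed.

(** The range [k <= t] makes the run of [k] failures start at slot 0 or later; for larger [k] the
    event also depends on [delta0]. *)
Lemma holding_time_geP t k w : (k <= t)%N ->
  (k <= delta t w)%N <-> (forall u, (u < t)%N -> (t - k <= u)%N -> gamma u w = false).
Proof.
elim: t k => [|t IH] [|k] kt //=; first by split=> // _ u ut; rewrite subn0 leqNgt ut.
rewrite subSS; case gt : (gamma t w).
  by split=> // /(_ t (ltnSn t) (leq_subr _ _)); rewrite gt.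
rewrite ltnS IH//; split=> H u ut; last by apply: H; rewrite leqW.
by move: ut; rewrite ltnS leq_eqVlt => /orP[/eqP->|]; [|exact: H].
Qed.

Lemma holding_time_ge_failures t k : (k <= t)%N ->
  [set w | (k <= delta t w)%N] = failures gamma t (fun u => (t - k <= u)%N).
Proof.
by move=> kt; apply/seteqP; split=> w; have [h1 h2] := holding_time_geP w kt; [exact: h1|exact: h2].
Qed.

Lemma measurable_holding_time_eq t k : measurable [set w | delta t w = k].
Proof.
elim: t k => [|t IH] k.
  have [->|/eqP nk] := eqVneq delta0 k.
    by rewrite (_ : [set _ | _] = setT)//; apply/seteqP; split.
  by rewrite (_ : [set _ | _] = set0)//; apply/seteqP; split.
have mg b := ch_gamma_measurable hch t b.
case: k => [|k].
  rewrite (_ : [set _ | _] = [set w | gamma t w = true])//.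
  by apply/seteqP; split=> w /=; case: (gamma t w).
rewrite (_ : [set _ | _] = [set w | gamma t w = false] `&` [set w | delta t w = k]).
  exact: measurableI.
apply/seteqP; split=> w /=; case: (gamma t w) => //; first by move=> [->].
  by case.
by case=> _ ->.
Qed.

Lemma measurable_holding_time t : measurable_fun setT (delta t).
Proof.
move=> _ Y _; rewrite setTI.
rewrite (_ : _ @^-1` _ = \bigcup_(k in Y) [set w | delta t w = k]).
  by apply: bigcup_measurable => k _; exact: measurable_holding_time_eq.
apply/seteqP; split=> [w Yw|w [k Yk dk]]; first by exists (delta t w).
by rewrite /preimage/= dk.
Qed.

Lemma measurable_holding_time_ge t k : measurable [set w | (k <= delta t w)%N].
Proof.
have := measurable_holding_time t measurableT (Y := [set n | (k <= n)%N]).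
by rewrite setTI; apply.
Qed.

Lemma prob_holding_time_ge t k : (k <= t)%N ->
  prob P [set w | (k <= delta t w)%N] =
  \sum_j (state_law P h (t - k) *m (diag_mx d *m Pi) ^+ k) 0 j.
Proof.
move=> kt; rewrite holding_time_ge_failures//.
by have := prob_failure_run hch (t - k) k; rewrite subnK.
Qed.

Lemma measurable_comp_holding_time (f : nat -> R) t :
  measurable_fun setT (EFin \o (f \o delta t)).
Proof.
apply/measurable_EFinP; apply: (measurableT_comp (f := f)) => //.
exact: measurable_holding_time.
Qed.

Lemma expectation_sum_holding_time (g : nat -> R) N t : (forall i, 0 <= g i) ->
  'E_P[fun w => (\sum_(i < N) g i * (i <= delta t w)%N%:R)%R]%E =
  (\sum_(i < N) g i * prob P [set w | (i <= delta t w)%N])%:E.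
Proof.
move=> g0; rewrite expectation.unlock.
under eq_integral do rewrite -sumEFin.
rewrite ge0_integral_sum//=; last 2 first.
- by move=> i; exact: (measurable_comp_holding_time (fun k => g i * (i <= k)%N%:R)).
- by move=> i w _; rewrite lee_fin mulr_ge0.
rewrite -sumEFin; apply: eq_bigr => i _.
under eq_integral do rewrite EFinM.
rewrite ge0_integralZl_EFin//; last first.
  exact: (measurable_comp_holding_time (fun k => (i <= k)%N%:R)).
rewrite EFinM; congr (_ * _)%E.
rewrite /prob fineK ?fin_num_measure//; last exact: measurable_holding_time_ge.
rewrite -[RHS](_ : P ([set w | (i <= delta t w)%N] `&` setT) = _); last by rewrite setIT.
rewrite -integral_indic//; last exact: measurable_holding_time_ge.
apply: eq_integral => w _; rewrite indicE; congr (_%:R%:E); congr nat_of_bool.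
by apply/idP/idP => [H|]; rewrite ?inE.
Qed.

Lemma le_expectation_holding_time (f1 f2 : nat -> R) t :
  (forall k, 0 <= f1 k) -> (forall k, (k <= t + delta0)%N -> f1 k <= f2 k) ->
  ('E_P[fun w => f1 (delta t w)] <= 'E_P[fun w => f2 (delta t w)])%E.
Proof.
move=> f10 f12; rewrite expectation.unlock; apply: ge0_le_integral => //.
- by move=> w _; rewrite lee_fin.
- exact: measurable_comp_holding_time.
- exact: measurable_comp_holding_time.
- by move=> w _; rewrite lee_fin f12// holding_time_le.
Qed.

(** Pointwise, [g] at the holding time is one of the terms of the sum of [g i] over all [i] up to
    the holding time. The sum is finite because the holding time is at most [t + delta0]. *)
Lemma expectation_holding_time_le (f g : nat -> R) t :
  (forall k, 0 <= f k <= g k) ->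
  ('E_P[fun w => f (delta t w)] <=
   (\sum_(i < (t + delta0).+1) g i * prob P [set w | (i <= delta t w)%N])%R%:E)%E.
Proof.
move=> fg; have f0 k : 0 <= f k by case/andP: (fg k).
have g0 k : 0 <= g k by case/andP: (fg k) => f0' /(le_trans f0').
rewrite -expectation_sum_holding_time//.
apply: (le_expectation_holding_time (f2 := fun k => \sum_(i < (t + delta0).+1) g i * (i <= k)%N%:R)) => // k kt.
have kt' : (k < (t + delta0).+1)%N by rewrite ltnS.
rewrite (bigD1 (Ordinal kt'))//= leqnn mulr1 ler_wpDr//.
  by apply: sumr_ge0 => i _; rewrite mulr_ge0.
by case/andP: (fg k).
Qed.

(** Summation by layers, truncated at [N]. The cutoff is arbitrary, so it can stay fixed while [t]
    grows. *)
Lemma expectation_holding_time_ge (f g : nat -> R) N t :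
  (forall i, 0 <= g i) -> (forall k, \sum_(i < k.+1) g i <= f k) ->
  ((\sum_(i < N) g i * prob P [set w | (i <= delta t w)%N])%R%:E <=
   'E_P[fun w => f (delta t w)])%E.
Proof.
move=> g0 gf; rewrite -expectation_sum_holding_time//.
apply: (le_expectation_holding_time (f1 := fun k => \sum_(i < N) g i * (i <= k)%N%:R)).
  by move=> k; apply: sumr_ge0 => i _; rewrite mulr_ge0.
move=> k _; apply: le_trans (gf k).
rewrite -(big_mkord xpredT (fun i => g i * (i <= k)%N%:R)) -(big_mkord xpredT).
(* Neither of [N] and [k.+1] need be the larger: extend to the maximum, then drop the indices above
   [k], where the indicator is 0. *)
apply: (le_trans (y := \sum_(0 <= i < maxn N k.+1) g i * (i <= k)%N%:R)).
  rewrite [leRHS](@big_cat_nat _ _ _ N)//= ?leq_maxl// lerDl.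
  by apply: sumr_ge0 => i _; rewrite mulr_ge0.
rewrite (@big_cat_nat _ _ _ k.+1)//= ?leq_maxr//.
rewrite [X in _ + X]big_nat_cond [X in _ + X]big1 ?addr0; last first.
  by move=> i /andP[/andP[ki _] _]; rewrite leqNgt ki mulr0.
by apply: ler_sum => i _; rewrite ler_piMr// lern1 leq_b1.
Qed.

Lemma mul_state_law_expmx_le s k (c q : R) :
  (forall i j, `|((diag_mx d *m Pi) ^+ k) i j| <= c * q ^+ k) ->
  \sum_j (state_law P h s *m (diag_mx d *m Pi) ^+ k) 0 j <= M%:R * (c * q ^+ k).
Proof.
move=> hc; have -> : M%:R * (c * q ^+ k) = \sum_(j < M) c * q ^+ k.
  by rewrite sumr_const card_ord mulr_natl.
apply: ler_sum => j _; rewrite mxE -[leRHS]mul1r -(state_law_sum1 hch s) mulr_suml.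
apply: ler_sum => i _; apply: ler_wpM2l; first exact: state_law_ge0.
exact: le_trans (ler_norm _) (hc i j).
Qed.

End HoldingTime.

(** * Limits superior and elementary estimates of sums *)

Section RealSequences.
Variable R : realType.

Lemma limn_esup_le (u : (\bar R)^nat) K : (forall n, (u n <= K)%E) -> (limn_esup u <= K)%E.
Proof.
move=> uK; apply: (@le_trans _ _ (ereal_sup (u @` setT)%classic)).
  by apply: ereal_inf_lbound; exists setT => //; exact: filterT.
by apply: ge_ereal_sup => _ [n _ <-].
Qed.

(** The limit superior is an infimum of suprema over tails, so some tail has a supremum below [+oo];
    if that supremum is [-oo], any real bound serves. *)
Lemma limn_esup_lty (u : (\bar R)^nat) : (limn_esup u < +oo)%E ->
  exists N, exists K : R, forall n, (N <= n)%N -> (u n <= K%:E)%E.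
Proof.
move=> /ereal_inf_lt[_ [V [N _ NV] <-] supV]; exists N.
have uV n : (N <= n)%N -> (u n <= ereal_sup (u @` V)%classic)%E.
  by move=> Nn; apply: ereal_sup_ubound; exists n => //; exact: NV.
case: (ereal_sup _) supV uV => [r| |] // _ uV; first by exists r.
by exists 0 => n /uV; rewrite leeNy_eq => /eqP ->; rewrite leNye.
Qed.

(** After the first [L] terms the range splits into [N] disjoint blocks of length [K], each
    contributing at least [s]. *)
Lemma sum_window_ge (u : nat -> R) K L s : (forall i, 0 <= u i) ->
  (forall t, (L <= t)%N -> s <= \sum_(k < K) u (t + k)%N) ->
  forall N, N%:R * s <= \sum_(i < L + N * K) u i.
Proof.
move=> u0 us; elim=> [|N IH]; first by rewrite mul0r sumr_ge0.
rewrite mulSnr addnA big_split_ord/= -natr1 mulrDl mul1r lerD//.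
by apply: us; rewrite leq_addr.
Qed.

(** Comparison of slopes as [N] grows: if [b < s], any [N] beyond [N0] and [|a| / (s - b)]
    contradicts the bound. *)
Lemma mulrn_linear_le (s a b : R) N0 :
  (forall N, (N0 <= N)%N -> N%:R * s <= a + N%:R * b) -> s <= b.
Proof.
move=> H; rewrite leNgt; apply/negP => bs.
have sb0 : 0 < s - b by rewrite subr_gt0.
pose N := maxn N0 (Num.truncn (`|a| / (s - b))).+1.
have : `|a| / (s - b) < N%:R.
  apply: (lt_le_trans (truncnS_gt _)); by rewrite ler_nat leq_maxr.
rewrite ltr_pdivrMr// ltNge => /negP; apply.
have := H N (leq_maxl _ _); rewrite -lerBlDr -mulrBr => /le_trans; apply.
exact: ler_norm.
Qed.

Lemma geometric_sum_le (x : R) N : 0 <= x -> x < 1 -> \sum_(i < N) x ^+ i <= (1 - x)^-1.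
Proof.
move=> x0 x1; have x1' : 0 < 1 - x by rewrite subr_gt0.
rewrite -[leRHS]mul1r ler_pdivlMr// mulrC -[1 - x]opprB mulNr -subrX1 opprB.
by rewrite gerBl exprn_ge0.
Qed.

End RealSequences.

(** * Sufficiency and necessity of the spectral condition *)

Section Stability.
Local Open Scope classical_set_scope.
Context (R : realType) (disp : measure_display) (Omega : measurableType disp).
Variable P : probability Omega R.
Context (n M : nat) (A W Pbar0 : 'M[R]_n) (Pi : 'M[R]_M) (d : 'rV[R]_M).
Context (h : nat -> Omega -> 'I_M) (gamma : nat -> Omega -> bool) (delta0 : nat).
Hypothesis hch : markov_fading_channel P Pi d h gamma.
Hypothesis (Wpsd : psdmx W) (Pbar0psd : psdmx Pbar0).
Hypothesis rhoA_ge1 : 1 <= spectral_radius A ^+ 2.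

Local Notation delta := (holding_time gamma delta0).
Local Notation B := (diag_mx d *m Pi).
Local Notation cost k := (\tr (iter k.+1 (predict_cov A W) Pbar0)).

Let sum_noise_gain_le k : \sum_(i < k.+1) noise_gain A W i <= cost k.
Proof. by rewrite mxtrace_iter_predict_cov lerDr; exact: mxtrace_congr_ge0. Qed.

Let cost_ge0 k : 0 <= cost k.
Proof.
by apply: le_trans (sum_noise_gain_le k); apply: sumr_ge0 => i _; exact: noise_gain_ge0.
Qed.

Lemma mean_square_stable_suff :
  spectral_radius A ^+ 2 * spectral_radius B < 1 ->
  mean_square_stable P A W Pbar0 delta.
Proof.
set a := spectral_radius A ^+ 2; set b := spectral_radius B => ab1.
have b0 : 0 <= b := spectral_radius_ge0 _.
have a0 : 0 <= a by rewrite (le_trans _ rhoA_ge1).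
(* Chosen so that [(a + e) (b + e) < 1]: since [e < 1], the excess [e (a + b + e)] over [a b] is at
   most [e (a + b + 1)], half of [1 - a b]. *)
pose e := (1 - a * b) / (2 * (a + b + 1)).
have den0 : 0 < 2 * (a + b + 1) by rewrite mulr_gt0// ltr_wpDl// addr_ge0.
have e0 : 0 < e by rewrite divr_gt0// subr_gt0.
have e1 : e < 1.
  rewrite ltr_pdivrMr// mul1r; have : 0 <= a * b by rewrite mulr_ge0.
  lra.
pose r := a + e; pose q := b + e.
have r1 : 1 < r by rewrite ltr_pwDr.
have ar : a < r by rewrite ltrDl.
have bq : b < q by rewrite ltrDl.
have q0 : 0 < q by exact: le_lt_trans bq.
have r0 : 0 < r by rewrite (lt_trans _ r1).
have rq1 : r * q < 1.
  have : e * (2 * (a + b + 1)) = 1 - a * b by rewrite divfK// gt_eqF.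
  rewrite /r /q; nra.
have q1 : q <= 1.
  by rewrite ltW// (le_lt_trans _ rq1)// ler_peMl// ltW.
have [c c0 hc] := mxtrace_iter_predict_cov_le W Pbar0 r1 ar.
have [D D0 hD] := expmx_spectral_bound bq.
(* For [i <= t] the tail formula applies. For [t < i <= t + delta0] the tail at [t] is used instead,
   and the loss is at most the factor [q ^- delta0] because [q <= 1]. *)
have prob_le t i : (i <= t + delta0)%N ->
    prob P [set w | (i <= delta t w)%N] <= M%:R * D / q ^+ delta0 * q ^+ i.
  move=> it.
  have base j : (j <= t)%N -> prob P [set w | (j <= delta t w)%N] <= M%:R * D * q ^+ j.
    move=> jt; rewrite (prob_holding_time_ge _ hch)// -mulrA.
    by apply: (mul_state_law_expmx_le hch) => k l; exact: hD.
  have qd0 : 0 < q ^+ delta0 by rewrite exprn_gt0.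
  have MD0 : 0 <= M%:R * D by rewrite mulr_ge0.
  rewrite mulrAC ler_pdivlMr//.
  have [jt|tj] := leqP i t.
    apply: le_trans (base i jt); rewrite ler_piMr ?prob_ge0//.
    by rewrite exprn_ile1// ltW.
  apply: (le_trans (y := M%:R * D * q ^+ t * q ^+ delta0)).
    apply: ler_wpM2r; first exact: ltW.
    apply: le_trans (base t (leqnn t)).
    apply: le_prob; try exact: (measurable_holding_time_ge _ hch).
    by move=> w /=; apply: leq_trans; exact: ltnW.
  by rewrite -mulrA -exprD; apply: ler_wpM2l => //; apply: ler_wiXn2l => //; exact: ltW.
have cr0 : 0 <= c * r by rewrite mulr_ge0// ltW.
have MDq0 : 0 <= M%:R * D / q ^+ delta0.
  by rewrite divr_ge0 ?mulr_ge0// exprn_ge0// ltW.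
(* The extra factor [r] comes from the exponent [k.+1] in the cost; the last factor is the sum of
   the geometric series of ratio [r q]. *)
pose K := c * r * (M%:R * D / q ^+ delta0) * (1 - r * q)^-1.
have E_le t : ('E_P[fun w => \tr (error_cov A W Pbar0 delta t w)] <= K%:E)%E.
  have fg k : 0 <= cost k <= c * r * r ^+ k.
    by rewrite cost_ge0 -mulrA -exprS; exact: hc.
  apply: le_trans (expectation_holding_time_le delta0 hch t fg) _.
  rewrite lee_fin.
  apply: (le_trans (y := c * r * (M%:R * D / q ^+ delta0) *
       \sum_(i < (t + delta0).+1) (r * q) ^+ i)).
    rewrite mulr_sumr; apply: ler_sum => i _.
    rewrite exprMn [leRHS](_ : _ = c * r * r ^+ i * (M%:R * D / q ^+ delta0 * q ^+ i)).
      apply: ler_wpM2l; last by apply: prob_le; rewrite -ltnS.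
      by rewrite mulr_ge0// exprn_ge0// ltW.
    by ring.
  apply: ler_wpM2l; first exact: mulr_ge0.
  by apply: geometric_sum_le => //; apply: mulr_ge0; exact: ltW.
have K0 : 0 <= K by rewrite -lee_fin; apply: le_trans (E_le 0%N); apply: expectation_ge0 => o; exact: cost_ge0.
apply: (@le_lt_trans _ _ K%:E); last exact: ltry.
apply: limn_esup_le => T.
apply: (@le_trans _ _ ((T%:R^-1)%:E * \sum_(1 <= t < T.+1) K%:E)%E).
  apply: lee_wpmul2l; first by rewrite lee_fin invr_ge0.
  by apply: lee_sum => t _; exact: E_le.
rewrite sumEFin -EFinM lee_fin sumr_const_nat subSS subn0 -[K *+ _]mulr_natl mulrA.
(* At [T = 0] the term is 0, which is why [K0] was established. *)
case: T => [|T]; first by rewrite mulr0 mul0r.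
by rewrite mulVf// mul1r.
Qed.

Lemma mean_square_stable_nec sqrtW :
  irreducible_chain Pi -> is_sqrtmx sqrtW W -> controllable A sqrtW ->
  mean_square_stable P A W Pbar0 delta ->
  spectral_radius A ^+ 2 * spectral_radius B < 1.
Proof.
move=> irr hsqrt ctr; rewrite /mean_square_stable => /limn_esup_lty[T0 [J hJ]].
rewrite ltNge; apply/negP.
set a := spectral_radius A ^+ 2; set b := spectral_radius B => ab1.
have b0 : 0 < b.
  rewrite lt_neqAle spectral_radius_ge0 andbT eq_sym; apply/eqP => b0.
  by move: ab1; rewrite b0 mulr0 ler10.
have rhoA0 : 0 < spectral_radius A.
  rewrite lt_neqAle spectral_radius_ge0 andbT eq_sym; apply/eqP => A0.
  by move: rhoA_ge1; rewrite A0 expr0n ler10.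
have [Pi0 _] := ch_stochastic hch.
have B0 i j : 0 <= B i j.
  by rewrite mul_diag_mx mxE mulr_ge0//; case/andP: (ch_drop_range hch i).
have [K [eta eta0 win]] := irreducible_window_ge Pi0 irr.
pose w i := noise_gain A W i.
have w0 i : 0 <= w i by exact: noise_gain_ge0.
pose beta i := \sum_l \sum_j (B ^+ i) l j.
have b_le i : b ^+ i <= beta i.
  apply: le_trans (spectral_radius_exp_le i b0) _.
  by apply: ler_sum => l _; apply: ler_sum => j _; rewrite ger0_norm// expmx_ge0.
have E_ge0 t : (0 <= 'E_P[fun w => \tr (error_cov A W Pbar0 delta t w)])%E.
  by apply: expectation_ge0 => o; exact: cost_ge0.
(* The bound is uniform in [L]. The truncated lower bound [e t] of the expected cost has averages
   from slot 1 at most [J], while every late window of [K.+1] slots contributes at least the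
   left-hand side. *)
have S_le L : eta * \sum_(i < L) w i * b ^+ i <= K.+1%:R * J.
  pose e t := \sum_(i < L) w i * prob P [set o | (i <= delta t o)%N].
  have e0 t : 0 <= e t by apply: sumr_ge0 => i _; rewrite mulr_ge0// prob_ge0.
  (* With [L <= t] every [i < L] is within the range of the tail formula, and the runs of length [i]
     ending just before the slots of the window start at consecutive times from [t - i] on; there
     the irreducibility bound applies. *)
  have e_win t : (L <= t)%N ->
      eta * \sum_(i < L) w i * b ^+ i <= \sum_(k < K.+1) e (t + k)%N.
    move=> Lt; rewrite exchange_big/= mulr_sumr; apply: ler_sum => i _.
    rewrite mulrCA -mulr_sumr; apply: ler_wpM2l => //.
    have it k : (i <= t + k)%N.
      by rewrite (leq_trans (ltnW (ltn_ord i)))// (leq_trans Lt)// leq_addr.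
    have it0 := it 0%N; rewrite addn0 in it0.
    have -> : \sum_(k < K.+1) prob P [set o | (i <= delta (t + k) o)%N] =
        \sum_l (\sum_(k < K.+1) (state_law P h (t - i) *m Pi ^+ k) 0 l) * \sum_j (B ^+ i) l j.
      transitivity (\sum_(k < K.+1) \sum_l
          (state_law P h (t - i) *m Pi ^+ k) 0 l * \sum_j (B ^+ i) l j).
        apply: eq_bigr => k _; rewrite (prob_holding_time_ge delta0 hch (it k)).
        rewrite addnC -addnBA// addnC (state_lawD hch).
        transitivity (\sum_j \sum_l
            (state_law P h (t - i) *m Pi ^+ k) 0 l * (B ^+ i) l j).
          by apply: eq_bigr => j _; rewrite mxE.
        by rewrite exchange_big/=; apply: eq_bigr => l _; rewrite mulr_sumr.
      by rewrite exchange_big/=; apply: eq_bigr => l _; rewrite mulr_suml.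
    apply: (le_trans (y := eta * beta i)).
      by apply: ler_wpM2l; [exact: ltW|exact: b_le].
    rewrite mulr_sumr; apply: ler_sum => l _; apply: ler_wpM2r.
      by apply: sumr_ge0 => j _; exact: expmx_ge0.
    by apply: win => [j|]; [exact: state_law_ge0|exact: (state_law_sum1 hch)].
  have e_tot T : (T0 <= T)%N -> \sum_(1 <= t < T.+1) e t <= T%:R * J.
    have [->|T_neq0] := eqVneq T 0%N; first by rewrite big_geq// mul0r.
    have T_gt0 : 0 < T%:R :> R by rewrite ltr0n lt0n.
    move=> /hJ.
    have : ((T%:R^-1 * \sum_(1 <= t < T.+1) e t)%:E <=
      (T%:R^-1)%:E * \sum_(1 <= t < T.+1)
        'E_P[fun o => \tr (error_cov A W Pbar0 delta t o)])%E.
      rewrite EFinM -sumEFin; apply: lee_wpmul2l; first by rewrite lee_fin invr_ge0.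
      apply: lee_sum => t _.
      exact: (expectation_holding_time_ge delta0 hch L t w0 sum_noise_gain_le).
    move=> /le_trans/[apply]; rewrite lee_fin mulrC.
    by rewrite ler_pdivrMr// mulrC.
  (* Compare growth in the number [N] of windows. The cost sums start at slot 1, so [e 0] goes into
     the constant, as do the first [L] slots. *)
  apply: (@mulrn_linear_le _ _ (e 0%N + L%:R * J) _ (T0 + 1)%N) => N TN.
  apply: le_trans (sum_window_ge e0 e_win N) _.
  have NT : (T0 <= L + N * K.+1)%N.
    by rewrite (leq_trans _ (leq_addl _ _))// mulnS (leq_trans _ (leq_addr _ _))// (leq_trans _ TN)// leq_addr.
  rewrite -addrA mulrA -mulrDl -natrM -natrD -(big_mkord xpredT).
  apply: le_trans (_ : \sum_(0 <= t < (L + N * K.+1).+1) e t <= _).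
    by rewrite big_nat_recr//= lerDl.
  by rewrite big_nat_recl// lerD2l; have := e_tot _ NT; rewrite big_add1.
have [c c0 hc] := controllable_spectral_radius_le hsqrt ctr rhoA0.
(* Then [m ^+ n] is at most [b ^+ k] for every [k <= n]. *)
pose m := Num.min 1 b.
have m0 : 0 < m by rewrite lt_min ltr01.
have u0 i : 0 <= w i * b ^+ i by rewrite mulr_ge0// exprn_ge0// ltW.
(* Since [a b >= 1], the factor [b ^+ t] compensates the growth [a ^+ t] of the noise gains, so each
   block of [n.+1] terms exceeds a fixed positive number. *)
have u_win t : (0 <= t)%N ->
    c^-1 * m ^+ n <= \sum_(k < n.+1) w (t + k)%N * b ^+ (t + k).
  move=> _; apply: (le_trans (y := m ^+ n * b ^+ t * \sum_(k < n.+1) w (t + k)%N)).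
    rewrite mulrC -mulrA; apply: ler_wpM2l; first by rewrite exprn_ge0// ltW.
    rewrite -[c^-1]mul1r ler_pdivrMr//.
    apply: (le_trans (y := b ^+ t * a ^+ t)).
      by rewrite -exprMn mulrC exprn_ege1.
    by rewrite -mulrA; apply: ler_wpM2l; [rewrite exprn_ge0// ltW|rewrite mulrC hc].
  rewrite mulr_sumr; apply: ler_sum => k _; rewrite mulrC; apply: ler_wpM2l => //.
  rewrite exprD mulrC; apply: ler_wpM2l; first by rewrite exprn_ge0// ltW.
  apply: (le_trans (y := m ^+ k)).
    apply: ler_wiXn2l; first exact: ltW.
      by rewrite ge_min lexx.
    by rewrite -ltnS.
  by apply: lerXn2r; rewrite ?nnegrE; [exact: ltW|exact: ltW|rewrite ge_min lexx orbT].
have s0 : 0 < c^-1 * m ^+ n by rewrite mulr_gt0 ?invr_gt0 ?exprn_gt0.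
suff : c^-1 * m ^+ n <= 0 by rewrite leNgt s0.
(* The blocks add up to at least [N] times that number, while [S_le] bounds all partial sums; slope
   0 on the right forces the number to be nonpositive. *)
apply: (@mulrn_linear_le _ _ (eta^-1 * (K.+1%:R * J)) _ 0%N) => N _.
rewrite mulr0 addr0; apply: le_trans (sum_window_ge u0 u_win N) _.
by rewrite add0n mulrC ler_pdivlMr// mulrC S_le.
Qed.

End Stability.

Unset Implicit Arguments.

Theorem theorem1
  (R : realType) (disp : measure_display) (Omega : measurableType disp)
  (P : probability Omega R) (n m M : nat)
  (A W sqrtW : 'M[R]_n) (C : 'M[R]_(m, n)) (V : 'M[R]_m)
  (x w xs xhat : nat -> Omega -> 'cV[R]_n) (y v : nat -> Omega -> 'cV[R]_m)
  (Ps : nat -> 'M[R]_n) (Pbar0 : 'M[R]_n)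
  (Pi : 'M[R]_M) (d : 'rV[R]_M)
  (h : nat -> Omega -> 'I_M) (gamma : nat -> Omega -> bool) (delta0 : nat)
  (hlti : lti_process A C x w y v)
  (hnoise : gaussian_noises P W V w v h gamma)
  (hrho : 1 <= spectral_radius A ^+ 2)
  (hobs : observable A C)
  (hsqrt : is_sqrtmx sqrtW W)
  (hctr : controllable A sqrtW)
  (hkf : kalman_filter A C W V y Ps xs)
  (hsteady : steady_state Ps Pbar0)
  (hch : markov_fading_channel P Pi d h gamma)
  (herg : ergodic_chain Pi)
  (hest : remote_estimator A gamma xs xhat) :
  mean_square_stable P A W Pbar0 (holding_time gamma delta0) <->
  spectral_radius A ^+ 2 * spectral_radius (diag_mx d *m Pi) < 1.

Proof.
have [irr _ _] := herg; have [Pbar0psd _] := hsteady.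
split; last exact: mean_square_stable_suff hch (noise_W hnoise) Pbar0psd hrho.
exact: mean_square_stable_nec hch (noise_W hnoise) Pbar0psd hrho _ irr hsqrt hctr.
Qed.
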